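(* Let $n\ge 2w\ge 2$ and $e\ge 1$ be integers, and let $\mathcal C$ be a nontrivial $e$-perfect code in $J(n,w)$, over $[n]$, with strength $\varphi$. Let $X,Y\subseteq[n]$ be two disjoint subsets with $|X|=r$, $|Y|=m$ and $r+m\le\varphi$. Then the number of codewords $c\in\mathcal C$ satisfying $X\subseteq c$ and $c\cap Y=\varnothing$ is $$\frac{1}{\Phi_e(n,w)}\binom{n-r-m}{w-r},$$ and hence $\Phi_e(n,w)$ divides $\binom{n-r-m}{w-r}$.
   Context: The Johnson scheme $J(n,w)$ has as elements all $w$-subsets of $[n]=\{1,\dots,n\}$, with distance $d(X,Y)=|X\setminus Y|$. The $e$-ball centred at $X$ is the set of $w$-subsets at distance at most $e$ from $X$; its size is $\Phi_e(n,w)=\sum_{i=0}^{e}\binom{w}{i}\binom{n-w}{i}$. An $e$-perfect code in $J(n,w)$ is a set $\mathcal C$ of $w$-subsets such that the $e$-balls centred at the elements of $\mathcal C$ partition the set of all $w$-subsets of $[n]$. It is trivial if $e=0$, or $|\mathcal C|=1$, or $n=2w$, $w=2e+1$ and $\mathcal C$ consists of a $w$-subset and its complement; otherwise it is nontrivial. A set $\mathcal C$ of $w$-subsets of $[n]$ is a $t$-design if there is $\lambda$ such that every $t$-subset of $[n]$ is contained in exactly $\lambda$ elements of $\mathcal C$. The strength $\varphi$ of $\mathcal C$ is the largest $t\le w$ for which $\mathcal C$ is a $t$-design. *)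

(* Defs.v *)
From mathcomp Require Import all_boot all_order all_algebra.

Set Implicit Arguments.
Unset Strict Implicit.
Unset Printing Implicit Defensive.

(* The ground set [n] = {1, ..., n} is represented by 'I_n. *)

Definition johnson (n w : nat) : {set {set 'I_n}} := [set X : {set 'I_n} | #|X| == w].

Definition jdist (n : nat) (X Y : {set 'I_n}) : nat := #|X :\: Y|.

Definition jball (n w e : nat) (X : {set 'I_n}) : {set {set 'I_n}} :=
  [set Y in johnson n w | jdist X Y <= e].

Definition Phi (e n w : nat) : nat :=
  \sum_(0 <= i < e.+1) 'C(w, i) * 'C(n - w, i).

(* The partition is that of the family of balls indexed by the codewords:
   [partition] on the image set [jball w e @: C] would identify distinct
   codewords having the same ball (which happens as soon as w <= e). *)
Definition perfect_code (n w e : nat) (C : {set {set 'I_n}}) : Prop :=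
  [/\ C \subset johnson n w,
      {in C &, forall c c', c != c' -> [disjoint jball w e c & jball w e c']} &
      \bigcup_(c in C) jball w e c = johnson n w].

Definition trivial_code (n w e : nat) (C : {set {set 'I_n}}) : Prop :=
  [\/ e = 0,
      #|C| = 1 |
      [/\ n = 2 * w, w = 2 * e + 1 &
          exists2 X : {set 'I_n}, #|X| = w & C = [set X; ~: X]]].

Definition is_design (n t : nat) (C : {set {set 'I_n}}) : Prop :=
  exists lambda : nat, forall T : {set 'I_n},
    #|T| = t -> #|[set c in C | T \subset c]| = lambda.

Definition is_strength (n w : nat) (C : {set {set 'I_n}}) (phi : nat) : Prop :=
  [/\ phi <= w, is_design phi C &
      forall t : nat, t <= w -> is_design t C -> t <= phi].

(* Main.v *)
Require Import Defs.
From mathcomp Require Import all_boot all_order all_algebra.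
From mathcomp Require Import zify.

Set Implicit Arguments.
Unset Strict Implicit.

(** The balls of an e-perfect code [C] partition the 'C(n, w) subsets of size
    [w], and all have the same size [Phi e n w]; hence Phi * #|C| = 'C(n, w).
    The theorem then follows from a fact about designs: if [C] has strength at
    least [r + m] and K * #|C| = 'C(n, w), then the codewords containing [X] and
    avoiding [Y] are 1 / K of all the [w]-subsets containing [X] and avoiding
    [Y], just as [C] itself is 1 / K of all the [w]-subsets.

    For Y = set0, counting pairs (codeword c containing X, point y of c outside
    X) gives
      (w - r) lambda(X) = sum over y outside X of lambda(y |: X),
    where lambda(X) counts the codewords containing X ([sum_codewords_setU1]).
    So a (t+1)-design is a t-design ([is_design_pred]), and the constants
    satisfy (w - t) lambda_t = (n - t) lambda_(t+1), which is also the recursion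
    satisfied by 'C(n - t, w - t): starting from lambda_0 = #|C|, the factor K
    propagates ([design_count_superset]).

    Forbidden points are then added one at a time: codewords avoiding y are all
    the codewords minus those containing y ([card_codewords_forbid1]), and on
    binomials this is Pascal's rule ([design_count]). *)

(** * Balls and the size of a perfect code *)

(** A [w]-subset [Y] at distance [i] from [c] is obtained by removing [i] points
    of [c] and adding [i] points outside [c]; these two sets are [c :\: Y] and
    [Y :\: c] and can be chosen independently. *)
Lemma card_jsphere (n w i : nat) (c : {set 'I_n}) : #|c| = w ->
  #|[set Y in johnson n w | jdist c Y == i]| = 'C(w, i) * 'C(n - w, i).
Proof.
move=> cw.
have cC : #|~: c| = n - w by rewrite cardsCs setCK card_ord cw.
have -> : 'C(w, i) * 'C(n - w, i) =
    #|setX [set A : {set 'I_n} | A \subset c & #|A| == i]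
           [set B : {set 'I_n} | B \subset ~: c & #|B| == i]|.
  by rewrite cardsX !cards_draws cw cC.
pose f (Y : {set 'I_n}) := (c :\: Y, Y :\: c).
pose g (p : {set 'I_n} * {set 'I_n}) := (c :\: p.1) :|: p.2.
have gK Y : g (f Y) = Y.
  by apply/setP=> x; rewrite !inE; case: (x \in c); case: (x \in Y).
rewrite -(card_imset _ (can_inj gK)); apply: eq_card => -[A B].
rewrite !inE /=; apply/imsetP/idP.
  case=> Y; rewrite !inE /jdist => /andP[/eqP Yw /eqP dY] [-> ->].
  rewrite subsetDl dY eqxx /= subsetDr /=.
  have := cardsID c Y; have := cardsID Y c.
  by rewrite [Y :&: c]setIC cw Yw dY => <- /addnI ->.
case/andP=> /andP[Ac /eqP Ai] /andP[Bc /eqP Bi].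
have fg : f (g (A, B)) = (A, B).
  congr pair; apply/setP=> x; rewrite !inE /=;
    have := subsetP Ac x; have := subsetP Bc x; rewrite !inE;
    case: (x \in A); case: (x \in B); case: (x \in c) => //= hB hA;
    by [have := hB isT | have := hA isT].
exists (g (A, B)) => //; rewrite !inE /jdist.
case: fg => e1 e2; rewrite e1 Ai eqxx andbT.
have := cardsID c (g (A, B)); have := cardsID (g (A, B)) c.
by rewrite [g _ :&: c]setIC e1 e2 Ai Bi cw => -> <-.
Qed.

Lemma card_jball (n w e : nat) (c : {set 'I_n}) : #|c| = w ->
  #|jball w e c| = Phi e n w.
Proof.
move=> cw; rewrite /Phi big_mkord.
under eq_bigr => i _ do rewrite -(card_jsphere i cw) -sum1_card.
rewrite -sum1_card.
rewrite (partition_big (fun Y => inord (jdist c Y) : 'I_e.+1) xpredT) //=.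
apply: eq_bigr => i _; apply: eq_bigl => Y; rewrite !inE -andbA; congr andb.
apply/andP/eqP => [[le_e /eqP <-]|Di]; first by rewrite inordK.
by rewrite Di -ltnS ltn_ord inord_val.
Qed.

Lemma perfect_code_card (n w e : nat) (C : {set {set 'I_n}}) :
  perfect_code w e C -> Phi e n w * #|C| = 'C(n, w).
Proof.
case=> sC dC cC.
have -> : 'C(n, w) = #|johnson n w| by rewrite card_draws card_ord.
rewrite -cC mulnC -sum_nat_const.
have -> : #|\bigcup_(c in C) jball w e c| = \sum_(c in C) #|jball w e c|.
  rewrite big_mkcond -sum1_card partition_disjoint_bigcup /=.
    rewrite [RHS]big_mkcond; apply: eq_bigr => c _; rewrite sum1_card.
    by case: ifP => // _; rewrite cards0.
  move=> c c' ne_cc'; case: ifP => cC1; last by rewrite -setI_eq0 set0I.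
  by case: ifP => cC2; [exact: dC | rewrite -setI_eq0 setI0].
apply: eq_bigr => c /(subsetP sC); rewrite inE => /eqP cw.
by rewrite card_jball.
Qed.

(** * Codewords containing a given set *)

Lemma sum_codewords_setU1 (n w : nat) (C : {set {set 'I_n}}) (X : {set 'I_n}) :
  C \subset johnson n w ->
  \sum_(y in ~: X) #|[set c in C | y |: X \subset c]|
    = (w - #|X|) * #|[set c in C | X \subset c]|.
Proof.
move=> sC.
under eq_bigr => y _ do rewrite -sum1_card.
rewrite (exchange_big_dep [in [set c in C | X \subset c]]) /=; last first.
  by move=> y c _; rewrite !inE subUset => /and3P[-> _ ->].
rewrite mulnC -sum_nat_const; apply: eq_bigr => c; rewrite inE => /andP[cC Xc].
have cw : #|c| = w by apply/eqP; have := subsetP sC c cC; rewrite inE.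
rewrite sum1_card -cw -(cardsDS Xc); apply: eq_card => y.
by rewrite !inE unfold_in !inE subUset sub1set cC Xc !andbT.
Qed.

Lemma sum_design_setU1 (n t lambda : nat) (C : {set {set 'I_n}})
    (X : {set 'I_n}) :
  (forall T : {set 'I_n}, #|T| = t.+1 ->
     #|[set c in C | T \subset c]| = lambda) ->
  #|X| = t ->
  \sum_(y in ~: X) #|[set c in C | y |: X \subset c]| = (n - t) * lambda.
Proof.
move=> HL Xt; rewrite -[n in RHS]card_ord -Xt -cardsT -(cardsDS (subsetT X)).
rewrite setTD -sum_nat_const; apply: eq_bigr => y; rewrite inE => yX.
by apply: HL; rewrite cardsU1 yX Xt.
Qed.

(** The two counts show that (w - t) * lambda(X) is the same for all [X] of
    size [t]; the assumption [t < w] allows the division. *)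
Lemma is_design_pred (n w t : nat) (C : {set {set 'I_n}}) :
  C \subset johnson n w -> t < w -> is_design t.+1 C -> is_design t C.
Proof.
move=> sC tw [L HL]; exists (((n - t) * L) %/ (w - t)) => X Xt.
rewrite -(sum_design_setU1 HL Xt) (sum_codewords_setU1 X sC) Xt mulKn //.
by rewrite subn_gt0.
Qed.

Lemma is_design_le (n w s t : nat) (C : {set {set 'I_n}}) :
  C \subset johnson n w -> s <= t -> t <= w -> is_design t C -> is_design s C.
Proof.
move=> sC; elim: t => [|t IH]; first by rewrite leqn0 => /eqP ->.
rewrite leq_eqVlt => /orP[/eqP -> //|st] tw dC.
by apply: IH => //; [exact: ltnW | exact: is_design_pred tw dC].
Qed.

(** [lambda_t] and 'C(n - t, w - t) obey the same recursion in [t], with initial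
    values #|C| and 'C(n, w). *)
Lemma design_count_superset (n w t K : nat) (C : {set {set 'I_n}})
    (X : {set 'I_n}) :
  C \subset johnson n w -> K * #|C| = 'C(n, w) -> t <= w -> is_design t C ->
  #|X| = t -> K * #|[set c in C | X \subset c]| = 'C(n - t, w - t).
Proof.
move=> sC KC; elim: t X => [|t IH] X tw dC Xt.
  rewrite !subn0 -KC; congr (_ * _); apply: eq_card => c.
  by rewrite !inE (cards0_eq Xt) sub0set andbT.
have dCt := is_design_pred sC tw dC.
have /card_gt0P[x xX] : 0 < #|X| by rewrite Xt.
have Zt : #|X :\ x| = t by have := cardsD1 x X; rewrite xX Xt; case.
have := IH _ (ltnW tw) dCt Zt.
case: dC => L HL; rewrite (HL _ Xt) => IHZ.
have tn : t < n by have := max_card X; rewrite Xt card_ord.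
have := sum_codewords_setU1 (X :\ x) sC.
rewrite (sum_design_setU1 HL Zt) Zt => E.
apply/eqP; rewrite -(eqn_pmul2l (_ : 0 < n - t)) ?subn_gt0 //.
rewrite mulnCA E mulnCA IHZ.
rewrite !subnS -(@prednK (n - t)) ?subn_gt0 // -(@prednK (w - t)) ?subn_gt0 //.
by rewrite -mul_bin_diag.
Qed.

(** * Adding forbidden points *)

Lemma card_codewords_forbid1 (n : nat) (C : {set {set 'I_n}})
    (X Y : {set 'I_n}) (y : 'I_n) :
  #|[set c in C | (y |: X \subset c) && (c :&: Y == set0)]|
  + #|[set c in C | (X \subset c) && (c :&: (y |: Y) == set0)]|
  = #|[set c in C | (X \subset c) && (c :&: Y == set0)]|.
Proof.
set S := [set c in C | (X \subset c) && (c :&: Y == set0)].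
rewrite -(cardsID [set c : {set 'I_n} | y \in c] S).
congr (_ + _); apply: eq_card => c; rewrite !inE.
  by rewrite subUset sub1set; case: (y \in c); rewrite /= ?andbT ?andbF.
rewrite setIUr setU_eq0 [c :&: [set y]]setIC setI_eq0 disjoints1.
by case: (y \in c); rewrite /= ?andbT ?andbF.
Qed.

(** By induction on [m]: the count for the triple (r, m + 1) is the difference
    of those for (r, m) and (r + 1, m), both within reach of the strength. *)
Lemma design_count (n w t r m K : nat) (C : {set {set 'I_n}})
    (X Y : {set 'I_n}) :
  C \subset johnson n w -> K * #|C| = 'C(n, w) -> t <= w -> is_design t C ->
  [disjoint X & Y] -> #|X| = r -> #|Y| = m -> r + m <= t ->
  K * #|[set c in C | (X \subset c) && (c :&: Y == set0)]|
    = 'C(n - r - m, w - r).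
Proof.
move=> sC KC tw dC; elim: m r X Y => [|m IH] r X Y dXY Xr Ym rmt.
  rewrite addn0 in rmt; rewrite subn0.
  have dCr := is_design_le sC rmt tw dC.
  rewrite -(design_count_superset sC KC (leq_trans rmt tw) dCr Xr).
  congr (_ * _); apply: eq_card => c.
  by rewrite !inE (cards0_eq Ym) setI0 eqxx andbT.
have /card_gt0P[y yY] : 0 < #|Y| by rewrite Ym.
have Zm : #|Y :\ y| = m by have := cardsD1 y Y; rewrite yY Ym; case.
have yX : y \notin X by rewrite (disjointFl dXY yY).
have dXZ : [disjoint X & Y :\ y] by apply: disjointWr dXY; apply: subD1set.
have dyXZ : [disjoint y |: X & Y :\ y].
  by rewrite -setI_eq0 setIUl setU_eq0 !setI_eq0 disjoints1 dXZ !inE eqxx.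
have yXr : #|y |: X| = r.+1 by rewrite cardsU1 yX Xr.
have E := card_codewords_forbid1 C X (Y :\ y) y.
rewrite setD1K // in E.
have E1 := IH _ _ _ dXZ Xr Zm (ltac:(lia)).
have E2 := IH _ _ _ dyXZ yXr Zm (ltac:(lia)).
rewrite -E mulnDr E2 in E1.
have nXY : r + m.+1 <= n.
  by have := max_card (mem (X :|: Y)); rewrite cardsU disjoint_setI0 // cards0
    subn0 Xr Ym card_ord.
have e1 : n - r - m = (n - r - m.+1).+1 by lia.
have e2 : w - r = (w - r.+1).+1 by lia.
have e3 : n - r.+1 - m = n - r - m.+1 by lia.
move: E1; rewrite e1 e2 e3 binS addnC => /eqP; rewrite eqn_add2r => /eqP //.
Qed.

(** * The count for perfect codes *)

Theorem theorem5p2 (n w e : nat) (C : {set {set 'I_n}}) (phi : nat)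
    (X Y : {set 'I_n}) (r m : nat)
    (hnw : 2 * w <= n) (hw : 2 <= 2 * w) (he : 1 <= e)
    (hC : perfect_code w e C) (hnt : ~ trivial_code w e C)
    (hphi : is_strength w C phi)
    (hXY : [disjoint X & Y]) (hX : #|X| = r) (hY : #|Y| = m)
    (hrm : r + m <= phi) :
  (#|[set c in C | (X \subset c) && (c :&: Y == set0)]|%:R
     = 1 / (Phi e n w)%:R * ('C(n - r - m, w - r))%:R :> rat)%R
  /\ Phi e n w %| 'C(n - r - m, w - r).
Proof.
have KC := perfect_code_card hC.
case: hC => sC _ _; case: hphi => phw dC _.
have <- := design_count sC KC phw dC hXY hX hY hrm.
split; last exact: dvdn_mulr.
have P0 : ((Phi e n w)%:R != 0 :> rat)%R.
  by rewrite Num.Theory.pnatr_eq0 /Phi big_nat_recl // !bin0.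
by rewrite GRing.natrM GRing.div1r GRing.mulKf.
Qed.
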